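(* In the setting of the context, let the precoders be those of the local zero-forcing (LZF) scheme: $$\bar{\mathbf w}_{sk}=\big[\bar{\mathbf G}_s(\bar{\mathbf G}_s^H\bar{\mathbf G}_s)^{-1}\big]_{(:,k)},\qquad \tilde{\mathbf w}_{sj}=\big[\tilde{\mathbf G}_s(\tilde{\mathbf G}_s^H\tilde{\mathbf G}_s)^{-1}\big]_{(:,j)},$$ where, if subarray $s$ serves a single user, the LZF precoder at subarray $s$ reduces to the maximum ratio transmission (MRT) precoder, i.e. $\bar{\mathbf w}_{sk}=\bar{\mathbf g}_{sk}$ if that single user is the near-field user $k$, and $\tilde{\mathbf w}_{sj}=\tilde{\mathbf g}_{sj}$ if it is the far-field user $j$. Then the spectral efficiency $\overline{\mathrm{SE}}_k$ of near-field user $k\in\mathcal{K_N}$ is $\overline{\mathrm{SE}}_k=\log_2(1+\overline{\mathrm{SINR}}_k)$ with $$\overline{\mathrm{SINR}}_k=\frac{P_n\Big(\sum_{s\in\bar{\mathcal S}_k}\sqrt{\bar\eta_{sk}}\Big)^2}{\bar\Delta+\sigma_k^2},$$ $$\bar\Delta=P_n\sum_{i\in\mathcal{K_N}\setminus\{k\}}\Big|\sum_{s\in\bar{\mathcal S}_i}\sqrt{\bar\eta_{si}}\,\bar{\mathbf g}_{sk}^H\bar{\mathbf w}_{si}\Big|^2+P_f\sum_{j\in\mathcal{K_F}}\sum_{s\in\tilde{\mathcal S}_j}\sum_{s'\in\tilde{\mathcal S}_j}\sqrt{\tilde\eta_{sj}\tilde\eta_{s'j}}\,\tilde\tau_{kj}^{ss'},$$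 where $\tilde\tau_{kj}^{ss'}=\Re\big\{\bar{\mathbf g}_{sk}^H\,\mathbb E\{\tilde{\mathbf w}_{sj}\tilde{\mathbf w}_{s'j}^H\}\,\bar{\mathbf g}_{s'k}\big\}$.
   Context: Array and users. A base-station planar array has $M=M_xM_y$ antennas ($M_x,M_y$ odd), spacing $d=\lambda/2$, wavelength $\lambda>0$, partitioned into $S$ subarrays of $M^\ast=M/S$ antennas each; subarray $s\in\mathcal S=\{1,\dots,S\}$ consists of the antennas with indices $r_s=\{(s-1)M^\ast+1,\dots,sM^\ast\}$. Near-field users: $\mathcal{K_N}=\{1,\dots,K_n\}$; far-field users: $\mathcal{K_F}=\{1,\dots,K_f\}$. A reconfigurable intelligent surface (RIS) has $N=N_1N_2$ elements and fixed phase matrix $\boldsymbol\Theta=\mathrm{diag}(e^{j\theta_1},\dots,e^{j\theta_N})$, $\theta_n\in[0,2\pi)$ real. Near-field channels (deterministic, line of sight). Antenna $m$ has coordinates $(m_xd,m_yd,0)$ with $m_x=-\frac{M_x-1}{2}+((m-1)\bmod M_x)$, $m_y=\frac{M_y-1}{2}-\lfloor (m-1)/M_x\rfloor$. User $k\in\mathcal{K_N}$ is at $(u_{k,x},u_{k,y},u_{k,z})$, $u_{k,z}>0$. Put $r_{m,k}=\sqrt{(u_{k,x}-m_xd)^2+(u_{k,y}-m_yd)^2+u_{k,z}^2}$, and $\bar g_{m,k}=\sqrt{\frac{A}{4\pi}\frac{u_{k,z}((u_{k,x}-m_xd)^2+u_{k,z}^2)}{r_{m,k}^5}}\;e^{-j2\pi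 r_{m,k}/\lambda}$ with $A=\lambda^2/(4\pi)$. The channel of subarray $s$ to user $k$ is $\bar{\mathbf g}_{sk}=[\bar g_{m,k}]_{m\in r_s}\in\mathbb C^{M^\ast}$, and $\bar{\mathbf G}_s=[\bar{\mathbf g}_{s1},\dots,\bar{\mathbf g}_{sK_n}]\in\mathbb C^{M^\ast\times K_n}$. Far-field channels. The array-to-RIS channel is $\mathbf H_2=\alpha_2\bar{\mathbf H}_2+\beta_2\tilde{\mathbf H}_2\in\mathbb C^{N\times M}$, where $\alpha_2=\sqrt{\iota\zeta/(\iota+1)}$, $\beta_2=\sqrt{\zeta/(\iota+1)}$ with $\iota\geq 0,\zeta>0$; $\bar{\mathbf H}_2=\mathbf b_N(\varphi^a,\varphi^e)\mathbf a_M(\phi^a,\phi^e)^H$ is deterministic, and $\tilde{\mathbf H}_2$ has i.i.d. $\mathcal{CN}(0,1)$ (circularly symmetric) entries. Here, with fixed real angles, $\mathbf a_M(\phi^a,\phi^e)=[e^{j2\pi m d\cos\phi^e\sin\phi^a/\lambda}]_{m=0}^{M_x-1}\otimes[e^{j2\pi m d\sin\phi^e/\lambda}]_{m=0}^{M_y-1}$ and $\mathbf b_N(\varphi^a,\varphi^e)=[e^{j2\pi n d_R\cos\varphi^e\sin\varphi^a/\lambda}]_{n=0}^{N_1-1}\otimes[e^{j2\pi n d_R\sin\varphi^e/\lambda}]_{n=0}^{N_2-1}$ (column vectors), $d_R=\lambda/2$. $\mathbf H_{2,s}\in\mathbb C^{N\times M^\ast}$ is the submatrix of $\mathbf H_2$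 with columns $r_s$. The RIS-to-user channel of $k\in\mathcal{K_F}$ is $\mathbf h_k=\sqrt{\varsigma_k}\,\mathbf b_N(\vartheta_k^a,\vartheta_k^e)\in\mathbb C^N$, $\varsigma_k>0$; the cascaded channel from subarray $s$ is $\tilde{\mathbf g}_{sk}^H=\mathbf h_k^H\boldsymbol\Theta\mathbf H_{2,s}$, and $\tilde{\mathbf G}_s=[\tilde{\mathbf g}_{s1},\dots,\tilde{\mathbf g}_{sK_f}]\in\mathbb C^{M^\ast\times K_f}$. $[\mathbf A]_{(:,k)}$ denotes the $k$th column of $\mathbf A$. It is assumed that $\bar{\mathbf G}_s^H\bar{\mathbf G}_s$ is invertible and $\tilde{\mathbf G}_s^H\tilde{\mathbf G}_s$ is almost surely invertible for every $s$, and that the precoders $\tilde{\mathbf w}_{sj}$ have finite second moments. Visibility regions and powers. $\bar{\mathcal S}_k\subseteq\mathcal S$ ($k\in\mathcal{K_N}$) and $\tilde{\mathcal S}_j\subseteq\mathcal S$ ($j\in\mathcal{K_F}$) are given sets of subarrays serving each user (visibility regions); subarray $s$ serves a user if $s$ belongs to that user's visibility region. $P_n,P_f>0$ are powers, $\bar\eta_{sk},\tilde\eta_{sj}\ge0$ are power-control coefficients, $\sigma_k^2>0$ is the noise power. Spectral efficiency of near-field user $k$ for given precoders $\bar{\mathbf w}_{sk},\tilde{\mathbf w}_{sj}\in\mathbb C^{M^\ast}$: by definition $\overline{\mathrm{SE}}_k=\log_2(1+\overline{\mathrm{SINR}}_k)$, where $$\overline{\mathrm{SINR}}_k=\frac{|\overline{\mathrm{DS}}_k|^2}{\sum_{i\in\mathcal{K_N}\setminus\{k\}}|\overline{\mathrm{UI}}^{\mathrm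 N}_i|^2+\sum_{j\in\mathcal{K_F}}\mathbb E\{|\overline{\mathrm{UI}}^{\mathrm F}_j|^2\}+\sigma_k^2},$$ $\overline{\mathrm{DS}}_k=\sqrt{P_n}\sum_{s\in\bar{\mathcal S}_k}\sqrt{\bar\eta_{sk}}\bar{\mathbf g}_{sk}^H\bar{\mathbf w}_{sk}$, $\overline{\mathrm{UI}}^{\mathrm N}_i=\sqrt{P_n}\sum_{s\in\bar{\mathcal S}_i}\sqrt{\bar\eta_{si}}\bar{\mathbf g}_{sk}^H\bar{\mathbf w}_{si}$, $\overline{\mathrm{UI}}^{\mathrm F}_j=\sqrt{P_f}\sum_{s\in\tilde{\mathcal S}_j}\sqrt{\tilde\eta_{sj}}\bar{\mathbf g}_{sk}^H\tilde{\mathbf w}_{sj}$. Expectations are over $\tilde{\mathbf H}_2$.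
   Formalization: The printed numerator is false if a subarray of user k's visibility region serves only user k (MRT gives the squared channel norm, not 1); it is proved when there is no such subarray, and in general with each such subarray's term multiplied by its squared channel norm. *)

(* Defs.v *)
From HB Require Import structures.
From mathcomp Require Import all_boot all_order all_algebra.
From mathcomp Require Import all_classical all_reals all_analysis.
From mathcomp Require Export complex.
From mathcomp Require Import mxtens.

Set Implicit Arguments.
Unset Strict Implicit.
Unset Printing Implicit Defensive.

Import Order.TTheory GRing.Theory Num.Theory.
Import numFieldNormedType.Exports.

Local Open Scope classical_set_scope.
Local Open Scope ring_scope.
Local Open Scope complex_scope.
Local Open Scope sesquilinear_scope.

Notation cabs := ComplexField.Normc.normc.

Definition cis {R : realType} (x : R) : R[i] := cos x +i* sin x.

Definition log2 {R : realType} (x : R) : R := ln x / ln 2.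

Section ComplexRandomVariables.
Context {R : realType} {d : measure_display} {T : measurableType d}.
Variable P : probability T R.

Definition cexp (Z : T -> R[i]) : R[i] :=
  fine ('E_P[fun t => complex.Re (Z t)])%E
    +i* fine ('E_P[fun t => complex.Im (Z t)])%E.

Definition mxexp {m n : nat} (Z : T -> 'M[R[i]]_(m, n)) : 'M[R[i]]_(m, n) :=
  \matrix_(i, j) cexp (fun t => Z t i j).

(* Circularly symmetric CN(0, 1): the real and imaginary parts are independent
   N(0, 1/2); [normal_prob] takes the standard deviation. *)
Definition std_complex_normal (Z : T -> R[i]) : Prop :=
  let X t := complex.Re (Z t) in
  let Y t := complex.Im (Z t) in
  [/\ measurable_fun setT X, measurable_fun setT Y,
      forall A, measurable A ->
        P (X @^-1` A) = normal_prob 0 (Num.sqrt 2^-1) A,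
      forall A, measurable A ->
        P (Y @^-1` A) = normal_prob 0 (Num.sqrt 2^-1) A &
      forall A B, measurable A -> measurable B ->
        P (X @^-1` A `&` Y @^-1` B) = (P (X @^-1` A) * P (Y @^-1` B))%E].

(* Choosing [A i := setT] outside a subfamily gives the product rule for that
   subfamily. *)
Definition mutually_independent (I : finType) (Z : I -> T -> R[i]) : Prop :=
  let XY i t := (complex.Re (Z i t), complex.Im (Z i t)) in
  forall A : I -> set (R * R)%type, (forall i, measurable (A i)) ->
    P (\bigcap_(i in setT) XY i @^-1` A i) = (\prod_i P (XY i @^-1` A i))%E.

End ComplexRandomVariables.

(* Users, subarrays, antennas and RIS elements are numbered from 0; [VRn],
   [VRf] are the visibility regions, and the suffixes [n], [f] stand for near
   and far field. *)
Record system (R : realType) := System {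
  Mx : nat; My : nat;
  nsub : nat;
  N1 : nat; N2 : nat;
  Kn : nat; Kf : nat;
  lambda : R;
  ux : 'I_Kn -> R; uy : 'I_Kn -> R; uz : 'I_Kn -> R;
  theta : 'I_(N1 * N2) -> R;
  iota_ : R; zeta : R;
  aod_az : R; aod_el : R;                         (* $\phi^a$, $\phi^e$ *)
  aoa_az : R; aoa_el : R;                         (* $\varphi^a$, $\varphi^e$ *)
  ris_az : 'I_Kf -> R; ris_el : 'I_Kf -> R;       (* $\vartheta^a_k$, $\vartheta^e_k$ *)
  varsigma : 'I_Kf -> R;
  VRn : 'I_Kn -> {set 'I_nsub}; VRf : 'I_Kf -> {set 'I_nsub};
  Pn : R; Pf : R;
  etan : 'I_nsub -> 'I_Kn -> R; etaf : 'I_nsub -> 'I_Kf -> R;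
  sigma2 : 'I_Kn -> R                             (* noise power $\sigma_k^2$ *)
}.

Section Model.
Context {R : realType}.
Variable sys : system R.
Local Notation C := R[i].
Local Notation Mx := (Mx sys).
Local Notation My := (My sys).
Local Notation nsub := (nsub sys).
Local Notation N1 := (N1 sys).
Local Notation N2 := (N2 sys).
Local Notation Kn := (Kn sys).
Local Notation Kf := (Kf sys).
Local Notation lambda := (lambda sys).

Definition nant : nat := (Mx * My)%N.
Definition Mstar : nat := (nant %/ nsub)%N.
Definition nris : nat := (N1 * N2)%N.
Definition spacing : R := lambda / 2.

Lemma ant_subproof (s : 'I_nsub) (i : 'I_Mstar) : (s * Mstar + i < nant)%N.
Proof.
apply: (@leq_trans (s.+1 * Mstar)); first by rewrite mulSn addnC ltn_add2r.
by apply: leq_trans (leq_divM nant nsub); rewrite mulnC leq_mul2l ltn_ord orbT.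
Qed.

Definition ant (s : 'I_nsub) (i : 'I_Mstar) : 'I_nant := Ordinal (ant_subproof s i).

Definition ant_x (m : 'I_nant) : R := - ((Mx%:R - 1) / 2) + (m %% Mx)%N%:R.
Definition ant_y (m : 'I_nant) : R := (My%:R - 1) / 2 - (m %/ Mx)%N%:R.

Definition dist (m : 'I_nant) (k : 'I_Kn) : R :=
  Num.sqrt ((ux k - ant_x m * spacing) ^+ 2 + (uy k - ant_y m * spacing) ^+ 2
            + uz k ^+ 2).

Definition gbar_coef (m : 'I_nant) (k : 'I_Kn) : C :=
  let A := lambda ^+ 2 / (4 * pi) in
  (Num.sqrt (A / (4 * pi)
     * (uz k * ((ux k - ant_x m * spacing) ^+ 2 + uz k ^+ 2) / dist m k ^+ 5)))%:C
  * cis (- (2 * pi * dist m k / lambda)).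

Definition gbar (s : 'I_nsub) (k : 'I_Kn) : 'cV[C]_Mstar :=
  \col_i gbar_coef (ant s i) k.

Definition Gbar (s : 'I_nsub) : 'M[C]_(Mstar, Kn) := \matrix_(i, k) gbar s k i 0.

(* The array and the RIS have the same spacing [lambda / 2]. *)
Definition steering (n1 n2 : nat) (az el : R) : 'cV[C]_(n1 * n2) :=
  (\col_(i < n1) cis (2 * pi * i%:R * spacing * cos el * sin az / lambda))
  *t (\col_(i < n2) cis (2 * pi * i%:R * spacing * sin el / lambda)).

Definition Theta : 'M[C]_nris := diag_mx (\row_n cis (theta n)).

Definition hchan (j : 'I_Kf) : 'cV[C]_nris :=
  (Num.sqrt (varsigma j))%:C *: steering N1 N2 (ris_az j) (ris_el j).

Definition H2bar : 'M[C]_(nris, nant) :=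
  steering N1 N2 (aoa_az sys) (aoa_el sys)
  *m (steering Mx My (aod_az sys) (aod_el sys))^t*.

(* [Ht] is a sample of the CN(0, 1) matrix. *)
Definition H2 (Ht : 'M[C]_(nris, nant)) : 'M[C]_(nris, nant) :=
  (Num.sqrt (iota_ sys * zeta sys / (iota_ sys + 1)))%:C *: H2bar
  + (Num.sqrt (zeta sys / (iota_ sys + 1)))%:C *: Ht.

Definition gtil (s : 'I_nsub) (j : 'I_Kf) (Ht : 'M[C]_(nris, nant)) :
    'cV[C]_Mstar :=
  ((hchan j)^t* *m Theta *m colsub (ant s) (H2 Ht))^t*.

Definition Gtil (s : 'I_nsub) (Ht : 'M[C]_(nris, nant)) : 'M[C]_(Mstar, Kf) :=
  \matrix_(i, j) gtil s j Ht i 0.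

(* Both kinds of users are counted. *)
Definition single_user (s : 'I_nsub) : bool :=
  (#|[pred k : 'I_Kn | s \in VRn k]| + #|[pred j : 'I_Kf | s \in VRf j]| == 1)%N.

Definition wbar_LZF (s : 'I_nsub) (k : 'I_Kn) : 'cV[C]_Mstar :=
  if single_user s && (s \in VRn k) then gbar s k
  else col k (Gbar s *m invmx ((Gbar s)^t* *m Gbar s)).

Definition wtil_LZF (s : 'I_nsub) (j : 'I_Kf) (Ht : 'M[C]_(nris, nant)) :
    'cV[C]_Mstar :=
  if single_user s && (s \in VRf j) then gtil s j Ht
  else col j (Gtil s Ht *m invmx ((Gtil s Ht)^t* *m Gtil s Ht)).

Section SpectralEfficiency.
Context {d : measure_display} {T : measurableType d}.
Variables (P : probability T R) (k : 'I_Kn).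
Variables (wbar : 'I_nsub -> 'I_Kn -> 'cV[C]_Mstar).
Variables (wtil : 'I_nsub -> 'I_Kf -> T -> 'cV[C]_Mstar).

Definition DS : C :=
  (Num.sqrt (Pn sys))%:C * \sum_(s in VRn k)
    (Num.sqrt (etan s k))%:C * ((gbar s k)^t* *m wbar s k) 0 0.

Definition UI_N (i : 'I_Kn) : C :=
  (Num.sqrt (Pn sys))%:C * \sum_(s in VRn i)
    (Num.sqrt (etan s i))%:C * ((gbar s k)^t* *m wbar s i) 0 0.

Definition UI_F (j : 'I_Kf) (t : T) : C :=
  (Num.sqrt (Pf sys))%:C * \sum_(s in VRf j)
    (Num.sqrt (etaf s j))%:C * ((gbar s k)^t* *m wtil s j t) 0 0.

Definition SINR : R :=
  cabs DS ^+ 2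
  / (\sum_(i | i != k) cabs (UI_N i) ^+ 2
     + \sum_j fine ('E_P[fun t => (cabs (UI_F j t) ^+ 2)%R])%E
     + sigma2 k).

Definition SE : R := log2 (1 + SINR).

End SpectralEfficiency.
End Model.

(* Main.v *)
(* Zero forcing makes every term [g_sk^H w_sk] of the desired signal equal to
   [1] (or to [|g_sk|^2] at an MRT subarray). The near-field interference is
   deterministic. For the far-field interference, expand [|sum_s c_s X_s|^2],
   where [X_s = g_sk^H w_sj], and exchange the sum with the expectation. This
   requires the products [w_sj w_s'j^H] to be integrable: their entries are
   measurable because the inverse matrix is the adjugate over the determinant,
   and they are dominated through [|z w| <= |z|^2 + |w|^2] by the finite second
   moments. *)

Require Import Defs.
From mathcomp Require Import all_boot all_order all_algebra.
From mathcomp Require Import all_classical all_reals all_analysis.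
From mathcomp Require Import measurable_realfun.
From mathcomp Require Import complex lra.
Import Order.TTheory GRing.Theory Num.Theory.
Import numFieldNormedType.Exports.
Local Open Scope classical_set_scope.
Local Open Scope ring_scope.
Local Open Scope complex_scope.
Local Open Scope sesquilinear_scope.

(** * Complex arithmetic and measurability of complex-valued functions *)

Section ComplexMeasurability.
Context {R : realType} {d : measure_display} {T : measurableType d}.
Implicit Types (Z W : T -> R[i]) (z w : R[i]).

Lemma ReM z w : complex.Re (z * w) =
  complex.Re z * complex.Re w - complex.Im z * complex.Im w.
Proof. by case: z w => [a b] [x y]. Qed.

Lemma ImM z w : complex.Im (z * w) =
  complex.Re z * complex.Im w + complex.Im z * complex.Re w.
Proof. by case: z w => [a b] [x y]. Qed.

Lemma ReD z w : complex.Re (z + w) = complex.Re z + complex.Re w.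
Proof. by case: z w => [a b] [x y]. Qed.

Lemma ImD z w : complex.Im (z + w) = complex.Im z + complex.Im w.
Proof. by case: z w => [a b] [x y]. Qed.

Lemma Re_sum (I : Type) (r : seq I) (Q : pred I) (f : I -> R[i]) :
  complex.Re (\sum_(i <- r | Q i) f i) = \sum_(i <- r | Q i) complex.Re (f i).
Proof. exact: (big_morph _ ReD). Qed.

Lemma ReJ z : complex.Re z^* = complex.Re z.
Proof. by case: z. Qed.

Lemma ImJ z : complex.Im z^* = - complex.Im z.
Proof. by case: z. Qed.

Lemma conj_realM (a : R) z : (a%:C * z)^* = a%:C * z^*.
Proof.
rewrite rmorphM; congr (_ * _); apply/eqP.
by rewrite eq_complex /= oppr0 !eqxx.
Qed.

Lemma cabs_sq z : cabs z ^+ 2 = complex.Re z ^+ 2 + complex.Im z ^+ 2.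
Proof. by case: z => a b /=; rewrite sqr_sqrtr// addr_ge0// sqr_ge0. Qed.

(** Turns a squared modulus into a product, which can then be expanded over a finite sum. *)
Lemma cabs_sqE z : (cabs z ^+ 2)%:C = z * z^*.
Proof.
rewrite cabs_sq; apply/eqP.
rewrite eq_complex ReM ImM ReJ ImJ /= mulrN opprK -!expr2.
by rewrite mulrN mulrC addNr !eqxx.
Qed.

Definition cmeasurable Z :=
  measurable_fun setT (fun t => complex.Re (Z t)) /\
  measurable_fun setT (fun t => complex.Im (Z t)).

Lemma cmeasurable_cst z : cmeasurable (fun=> z).
Proof. by split; exact: measurable_cst. Qed.

Lemma cmeasurableD Z W : cmeasurable Z -> cmeasurable W ->
  cmeasurable (fun t => Z t + W t).
Proof.
move=> [? ?] [? ?]; split.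
- by under eq_fun do rewrite ReD; exact: measurable_funD.
- by under eq_fun do rewrite ImD; exact: measurable_funD.
Qed.

Lemma cmeasurableM Z W : cmeasurable Z -> cmeasurable W ->
  cmeasurable (fun t => Z t * W t).
Proof.
move=> [? ?] [? ?]; split.
- by under eq_fun do rewrite ReM; apply: measurable_funB; exact: measurable_funM.
- by under eq_fun do rewrite ImM; apply: measurable_funD; exact: measurable_funM.
Qed.

Lemma cmeasurableJ Z : cmeasurable Z -> cmeasurable (fun t => (Z t)^*).
Proof.
move=> [? ?]; split.
- by under eq_fun do rewrite ReJ.
- by under eq_fun do rewrite ImJ; exact: measurable_funN.
Qed.

Lemma cmeasurable_sum (I : Type) (r : seq I) (Q : pred I) (Z : I -> T -> R[i]) :
  (forall i, cmeasurable (Z i)) ->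
  cmeasurable (fun t => \sum_(i <- r | Q i) Z i t).
Proof.
move=> mZ; elim: r => [|i r ih].
  by under eq_fun do rewrite big_nil; exact: cmeasurable_cst.
under eq_fun do rewrite big_cons.
by case: (Q i) => //; exact: cmeasurableD.
Qed.

Lemma cmeasurable_prod (I : Type) (r : seq I) (Q : pred I) (Z : I -> T -> R[i]) :
  (forall i, cmeasurable (Z i)) ->
  cmeasurable (fun t => \prod_(i <- r | Q i) Z i t).
Proof.
move=> mZ; elim: r => [|i r ih].
  by under eq_fun do rewrite big_nil; exact: cmeasurable_cst.
under eq_fun do rewrite big_cons.
by case: (Q i) => //; exact: cmeasurableM.
Qed.

(** The inverse is the conjugate divided by the squared modulus, and the real inverse of a
    nonnegative quantity is the power [-1], a measurable function. Zeros of [Z] are covered: the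
    real inverse, the complex inverse and the power all send 0 to 0. *)
Lemma cmeasurableV Z : cmeasurable Z -> cmeasurable (fun t => (Z t)^-1).
Proof.
move=> [mX mY].
have mn : measurable_fun setT
    (fun t => (complex.Re (Z t) ^+ 2 + complex.Im (Z t) ^+ 2)^-1 : R).
  under eq_fun do rewrite -powR_inv1 ?addr_ge0 ?sqr_ge0//.
  apply: (@measurableT_comp _ _ _ _ _ _ (@powR R ^~ (-1))) => /=.
    exact: measurable_powR.
  by apply: measurable_funD; exact: measurable_funX.
have VE z : z^-1 = complex.Re z / (complex.Re z ^+ 2 + complex.Im z ^+ 2)
    -i* (complex.Im z / (complex.Re z ^+ 2 + complex.Im z ^+ 2)).
  by case: z.
split; under eq_fun do rewrite VE /=.
- exact: measurable_funM.
- by apply: measurable_funN; exact: measurable_funM.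
Qed.

(** Serves to make the test [\det (A t) == 0] measurable in [mxmeasurable_inv]. *)
Lemma measurable_fun_ceq Z z : cmeasurable Z ->
  measurable_fun setT (fun t => Z t == z).
Proof.
move=> [? ?]; under eq_fun do rewrite eq_complex.
by apply: measurable_and; apply: measurable_fun_eqr => //; exact: measurable_cst.
Qed.

Lemma cmeasurable_if (b : T -> bool) Z W : measurable_fun setT b ->
  cmeasurable Z -> cmeasurable W -> cmeasurable (fun t => if b t then Z t else W t).
Proof.
move=> mb [? ?] [? ?]; split.
- by under eq_fun do rewrite (fun_if (@complex.Re R)); exact: measurable_fun_ifT.
- by under eq_fun do rewrite (fun_if (@complex.Im R)); exact: measurable_fun_ifT.
Qed.

(** * Measurability of matrix-valued functions *)

Definition mxmeasurable {m n} (A : T -> 'M[R[i]]_(m, n)) :=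
  forall i j, cmeasurable (fun t => A t i j).

Lemma mxmeasurable_cst m n (A : 'M[R[i]]_(m, n)) : mxmeasurable (fun=> A).
Proof. by move=> i j; exact: cmeasurable_cst. Qed.

Lemma mxmeasurableD m n (A B : T -> 'M[R[i]]_(m, n)) :
  mxmeasurable A -> mxmeasurable B -> mxmeasurable (fun t => A t + B t).
Proof.
by move=> mA mB i j; under eq_fun do rewrite mxE; exact: cmeasurableD.
Qed.

Lemma mxmeasurableZ m n Z (A : T -> 'M[R[i]]_(m, n)) :
  cmeasurable Z -> mxmeasurable A -> mxmeasurable (fun t => Z t *: A t).
Proof.
by move=> mZ mA i j; under eq_fun do rewrite mxE; exact: cmeasurableM.
Qed.

Lemma mxmeasurableM m n p (A : T -> 'M[R[i]]_(m, n)) (B : T -> 'M[R[i]]_(n, p)) :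
  mxmeasurable A -> mxmeasurable B -> mxmeasurable (fun t => A t *m B t).
Proof.
move=> mA mB i j; under eq_fun do rewrite mxE.
by apply: cmeasurable_sum => l; exact: cmeasurableM.
Qed.

Lemma mxmeasurable_adj m n (A : T -> 'M[R[i]]_(m, n)) :
  mxmeasurable A -> mxmeasurable (fun t => (A t)^t*).
Proof.
by move=> mA i j; under eq_fun do rewrite 2!mxE; exact: cmeasurableJ.
Qed.

Lemma cmeasurable_det n (A : T -> 'M[R[i]]_n) :
  mxmeasurable A -> cmeasurable (fun t => \det (A t)).
Proof.
move=> mA; rewrite /determinant; apply: cmeasurable_sum => s.
apply: cmeasurableM; first exact: cmeasurable_cst.
by apply: cmeasurable_prod => i; exact: mA.
Qed.

(** [invmx] returns its argument on a singular matrix, so each entry is a case distinction on the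
    measurable event that the determinant vanishes. Off this event it is a cofactor over the
    determinant, and the cofactor is again a determinant of measurable entries. *)
Lemma mxmeasurable_inv n (A : T -> 'M[R[i]]_n) :
  mxmeasurable A -> mxmeasurable (fun t => invmx (A t)).
Proof.
move=> mA i j; rewrite /invmx.
have ifE t : (if A t \in unitmx then (\det (A t))^-1 *: \adj (A t) else A t) i j
    = if \det (A t) == 0 then A t i j
      else (\det (A t))^-1 * ((-1) ^+ (j + i) * \det (row' j (col' i (A t)))).
  by rewrite unitmxE unitfE; case: eqP => // _; rewrite !mxE.
under eq_fun do rewrite ifE.
apply: cmeasurable_if.
- exact/measurable_fun_ceq/cmeasurable_det.
- exact: mA.
apply: cmeasurableM; first exact/cmeasurableV/cmeasurable_det.
apply: cmeasurableM; first exact: cmeasurable_cst.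
by apply: cmeasurable_det => a b; under eq_fun do rewrite !mxE; exact: mA.
Qed.

End ComplexMeasurability.

(** * Complex integrability, linearity of the expectation, and second moments *)

Section ComplexExpectation.
Context {R : realType} {d : measure_display} {T : measurableType d}.
Variable P : probability T R.
Implicit Types (Z W : T -> R[i]) (z w : R[i]).

Definition cintegrable Z :=
  P.-integrable setT (fun t => (complex.Re (Z t))%:E) /\
  P.-integrable setT (fun t => (complex.Im (Z t))%:E).

(** Unlocking the expectation gives access to the linearity of [Rintegral], used on each real
    part. *)
Lemma cexpE Z : cexp P Z =
  (\int[P]_t complex.Re (Z t)) +i* (\int[P]_t complex.Im (Z t)).
Proof. by rewrite /cexp !unlock. Qed.

Lemma cintegrable0 : cintegrable (fun=> 0).
Proof. by split; exact: integrable0. Qed.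

Lemma cexp0 : cexp P (fun=> 0) = 0.
Proof. by rewrite cexpE /= !Rintegral_cst// !mul0r. Qed.

Lemma cintegrableD Z W : cintegrable Z -> cintegrable W ->
  cintegrable (fun t => Z t + W t).
Proof.
move=> [? ?] [? ?]; split.
- by under eq_fun do rewrite ReD EFinD; exact: integrableD.
- by under eq_fun do rewrite ImD EFinD; exact: integrableD.
Qed.

Lemma cexpD Z W : cintegrable Z -> cintegrable W ->
  cexp P (fun t => Z t + W t) = cexp P Z + cexp P W.
Proof.
move=> [? ?] [? ?]; rewrite !cexpE; apply/eqP; rewrite eq_complex ReD ImD /=.
under eq_Rintegral do rewrite ReD.
rewrite RintegralD// eqxx /=.
under eq_Rintegral do rewrite ImD.
by rewrite RintegralD.
Qed.

Lemma cintegrableZ z Z : cintegrable Z -> cintegrable (fun t => z * Z t).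
Proof.
move=> [iX iY]; split.
- under eq_fun do rewrite ReM EFinB !EFinM.
  by apply: integrableB => //; exact: integrableZl.
- under eq_fun do rewrite ImM EFinD !EFinM.
  by apply: integrableD => //; exact: integrableZl.
Qed.

Lemma cexpZ z Z : cintegrable Z -> cexp P (fun t => z * Z t) = z * cexp P Z.
Proof.
move=> [iX iY]; rewrite !cexpE; apply/eqP; rewrite eq_complex ReM ImM /=.
have iZ (a : R) (f : T -> R) : P.-integrable setT (EFin \o f) ->
    P.-integrable setT (EFin \o (fun t => a * f t)).
  by move=> If; exact: (integrableZl measurableT a If).
under eq_Rintegral do rewrite ReM.
rewrite RintegralB//; [|exact: iZ..].
rewrite !RintegralZl// eqxx /=.
under eq_Rintegral do rewrite ImM.
rewrite RintegralD//; [|exact: iZ..].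
by rewrite !RintegralZl.
Qed.

Lemma cintegrable_sum (I : Type) (r : seq I) (Q : pred I) (Z : I -> T -> R[i]) :
  (forall i, cintegrable (Z i)) ->
  cintegrable (fun t => \sum_(i <- r | Q i) Z i t).
Proof.
move=> iZ; elim: r => [|i r ih].
  by under eq_fun do rewrite big_nil; exact: cintegrable0.
under eq_fun do rewrite big_cons.
by case: (Q i) => //; exact: cintegrableD.
Qed.

Lemma cexp_sum (I : Type) (r : seq I) (Q : pred I) (Z : I -> T -> R[i]) :
  (forall i, cintegrable (Z i)) ->
  cexp P (fun t => \sum_(i <- r | Q i) Z i t) = \sum_(i <- r | Q i) cexp P (Z i).
Proof.
move=> iZ; elim: r => [|i r ih].
  by under eq_fun do rewrite big_nil; rewrite big_nil cexp0.
under eq_fun do rewrite big_cons.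
rewrite big_cons; case: (Q i) => //.
by rewrite cexpD ?ih//; exact: cintegrable_sum.
Qed.

Lemma cintegrable_mulJ Z W : cmeasurable Z -> cmeasurable W ->
  ('E_P[fun t => (cabs (Z t) ^+ 2)%R] < +oo)%E ->
  ('E_P[fun t => (cabs (W t) ^+ 2)%R] < +oo)%E ->
  cintegrable (fun t => Z t * (W t)^*).
Proof.
move=> mZ mW; rewrite !unlock => Z2 W2.
have sq_int V : cmeasurable V -> (\int[P]_t (cabs (V t) ^+ 2)%:E < +oo)%E ->
    P.-integrable setT (fun t => (cabs (V t) ^+ 2)%:E).
  move=> [mX mY] V2; apply/integrableP; split.
    apply/measurable_EFinP; under eq_fun do rewrite cabs_sq.
    by apply: measurable_funD; exact: measurable_funX.
  by under eq_integral do rewrite gee0_abs ?lee_fin ?sqr_ge0//.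
have iS := integrableD measurableT (sq_int _ mZ Z2) (sq_int _ mW W2).
(* With z = a + ib and w = x + iy, the real part of z times the conjugate of w is ax + by, and the
   imaginary part is a(-y) + bx; one inequality serves both. *)
have bound (a b x y : R) :
    `|a * x + b * y| <= a ^+ 2 + b ^+ 2 + (x ^+ 2 + y ^+ 2).
  have sqD u v : 0 <= u ^+ 2 + v ^+ 2 :> R by rewrite addr_ge0 ?sqr_ge0.
  rewrite ler_norml; apply/andP; split.
    (* Expanding the squares of [a + x] and [b + y] bounds twice the product sum; the two other
       nonnegative sums absorb the spare factor 2. The upper bound uses differences instead. *)
    have := sqD (a + x) (b + y); have := sqD a b; have := sqD x y; nra.
  have := sqD (a - x) (b - y); have := sqD a b; have := sqD x y; nra.
have [mX mY] : cmeasurable (fun t => Z t * (W t)^*).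
  exact/cmeasurableM/cmeasurableJ.
split.
- apply: le_integrable iS => //; first exact/measurable_EFinP.
  move=> t _ /=; rewrite lee_fin ReM ReJ ImJ mulrN opprK.
  rewrite [leRHS]ger0_norm ?addr_ge0 ?sqr_ge0//.
  by rewrite !cabs_sq bound.
- apply: le_integrable iS => //; first exact/measurable_EFinP.
  move=> t _ /=; rewrite lee_fin ImM ReJ ImJ.
  rewrite [leRHS]ger0_norm ?addr_ge0 ?sqr_ge0//.
  (* Brings the bound to the shape of [bound] with (x, y) replaced by (-y, x). *)
  rewrite !cabs_sq -(sqrrN (complex.Im (W t))) (addrC (complex.Re (W t) ^+ 2)).
  exact: bound.
Qed.

(** Linearity moves the expectation onto the middle matrix, entry by entry. This is what produces
    the matrix expectation inside [tau]. *)
Lemma cexp_bilinear m n (u : 'rV[R[i]]_m) (Z : T -> 'M[R[i]]_(m, n))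
    (v : 'cV[R[i]]_n) :
  (forall i j, cintegrable (fun t => Z t i j)) ->
  cintegrable (fun t => (u *m Z t *m v) 0 0) /\
  cexp P (fun t => (u *m Z t *m v) 0 0) = (u *m mxexp P Z *m v) 0 0.
Proof.
move=> iZ.
have bE (A : 'M[R[i]]_(m, n)) :
    (u *m A *m v) 0 0 = \sum_j v j 0 * (\sum_i u 0 i * A i j).
  by rewrite mxE; apply: eq_bigr => j _; rewrite mxE mulrC.
have iuZ j : cintegrable (fun t => \sum_i u 0 i * Z t i j).
  by apply: cintegrable_sum => i; exact: cintegrableZ.
under eq_fun do rewrite bE.
split; first by apply: cintegrable_sum => j; exact: cintegrableZ.
rewrite cexp_sum => [|j]; last exact: cintegrableZ.
rewrite bE; apply: eq_bigr => j _; rewrite cexpZ//; congr (_ * _).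
rewrite cexp_sum => [|i]; last exact: cintegrableZ.
by apply: eq_bigr => i _; rewrite cexpZ// mxE.
Qed.

(** The squared modulus is a double sum of cross terms with real coefficients. The left side is
    real, so taking real parts after the complex expectation loses nothing, and real coefficients
    commute with the real part. *)
Lemma expectation_cabs_sq_sum (I : finType) (A : {set I}) (c : I -> R)
    (X : I -> T -> R[i]) :
  (forall s s', cintegrable (fun t => X s t * (X s' t)^*)) ->
  fine ('E_P[fun t => (cabs (\sum_(s in A) (c s)%:C * X s t) ^+ 2)%R])%E =
  \sum_(s in A) \sum_(s' in A)
    c s * c s' * complex.Re (cexp P (fun t => X s t * (X s' t)^*)).
Proof.
move=> iX.
have sqE t : (cabs (\sum_(s in A) (c s)%:C * X s t) ^+ 2)%:C =
    \sum_(s in A) \sum_(s' in A) (c s * c s')%:C * (X s t * (X s' t)^*).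
  rewrite cabs_sqE rmorph_sum mulr_suml; apply: eq_bigr => s _.
  rewrite mulr_sumr; apply: eq_bigr => s' _.
  by rewrite [X in _ * X]conj_realM [(_ * _)%:C]rmorphM mulrACA.
(* A real expectation is the real part of the complex expectation of the embedded function. *)
have -> : fine ('E_P[fun t => (cabs (\sum_(s in A) (c s)%:C * X s t) ^+ 2)%R])%E =
    complex.Re (cexp P (fun t =>
      \sum_(s in A) \sum_(s' in A) (c s * c s')%:C * (X s t * (X s' t)^*))).
  by congr (fine 'E_P[_])%E; apply/funext => t; rewrite -sqE.
rewrite cexp_sum => [|s]; last first.
  by apply: cintegrable_sum => s'; exact: cintegrableZ.
rewrite Re_sum; apply: eq_bigr => s _.
rewrite cexp_sum => [|s']; last exact: cintegrableZ.
rewrite Re_sum; apply: eq_bigr => s' _.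
by rewrite cexpZ// ReM mul0r subr0.
Qed.

End ComplexExpectation.

(** * Gains and measurability of the LZF precoders *)

Section LocalZeroForcing.
Context {R : realType} (sys : system R).

(** The scalar is the diagonal entry [j] of the Gram matrix times its inverse, hence of the
    identity. *)
Lemma zero_forcing m n (G : 'M[R[i]]_(m, n)) (j : 'I_n) :
  G^t* *m G \in unitmx ->
  ((col j G)^t* *m col j (G *m invmx (G^t* *m G))) 0 0 = 1.
Proof.
move=> uG.
transitivity ((G^t* *m (G *m invmx (G^t* *m G))) j j).
  by rewrite mxE [RHS]mxE; apply: eq_bigr => i _; rewrite !mxE.
by rewrite mulmxA mulmxV// mxE eqxx.
Qed.

Lemma gbar_wbar_LZF (k : 'I_(Kn sys)) (s : 'I_(nsub sys)) :
  (Gbar s)^t* *m Gbar s \in unitmx -> s \in VRn k ->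
  ((gbar s k)^t* *m wbar_LZF s k) 0 0 =
  (if single_user s then \sum_i cabs (gbar s k i 0) ^+ 2 else 1)%:C.
Proof.
move=> uG sk; rewrite /wbar_LZF sk andbT; case: single_user.
  rewrite mxE rmorph_sum; apply: eq_bigr => i _.
  by rewrite [RHS]cabs_sqE mulrC !mxE.
have -> : gbar s k = col k (Gbar s) by apply/colP => i; rewrite !mxE.
exact: zero_forcing.
Qed.

Context {d : measure_display} {T : measurableType d}.

(** The channel is the adjoint of a constant row times an affine function of the sample. *)
Lemma mxmeasurable_gtil (s : 'I_(nsub sys)) (j : 'I_(Kf sys))
    (H : T -> 'M[R[i]]_(nris sys, nant sys)) :
  mxmeasurable H -> mxmeasurable (fun t => gtil s j (H t)).
Proof.
move=> mH; have mH2 : mxmeasurable (fun t => H2 (H t)).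
  apply: mxmeasurableD; first exact: mxmeasurable_cst.
  by apply: mxmeasurableZ => //; exact: cmeasurable_cst.
rewrite /gtil; apply/mxmeasurable_adj/mxmeasurableM.
  exact: mxmeasurable_cst.
by move=> a b; under eq_fun do rewrite mxE; exact: mH2.
Qed.

(** The choice between MRT and zero forcing depends on [s] and [j], not on the sample, so each
    branch is handled separately. *)
Lemma mxmeasurable_wtil_LZF (s : 'I_(nsub sys)) (j : 'I_(Kf sys))
    (H : T -> 'M[R[i]]_(nris sys, nant sys)) :
  mxmeasurable H -> mxmeasurable (fun t => wtil_LZF s j (H t)).
Proof.
move=> mH; rewrite /wtil_LZF; case: (_ && _); first exact: mxmeasurable_gtil.
have mG : mxmeasurable (fun t => Gtil s (H t)).
  by move=> a b; under eq_fun do rewrite mxE; exact: mxmeasurable_gtil.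
move=> a b; under eq_fun do rewrite mxE.
apply: mxmeasurableM => //; apply/mxmeasurable_inv/mxmeasurableM => //.
exact: mxmeasurable_adj.
Qed.

End LocalZeroForcing.

(** At an MRT subarray the desired-signal gain is the squared norm of the channel instead of 1. The
    first conjunct therefore assumes that no subarray serving [k] serves a single user; the second
    covers the general case with the gain written out. *)
Theorem proposition5 (R : realType) (sys : system R)
  (d : measure_display) (T : measurableType d) (P : probability T R)
  (Ht : T -> 'M[R[i]]_(nris sys, nant sys)) (k : 'I_(Kn sys)) :
  odd (Mx sys) -> odd (My sys) -> (nsub sys %| nant sys)%N ->
  0 < lambda sys ->
  (forall i : 'I_(Kn sys), 0 < uz i) ->
  (forall n : 'I_(nris sys), 0 <= theta n < 2 * pi) ->
  0 <= iota_ sys -> 0 < zeta sys ->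
  (forall j : 'I_(Kf sys), 0 < varsigma j) ->
  0 < Pn sys -> 0 < Pf sys ->
  (forall (s : 'I_(nsub sys)) (i : 'I_(Kn sys)), 0 <= etan s i) ->
  (forall (s : 'I_(nsub sys)) (j : 'I_(Kf sys)), 0 <= etaf s j) ->
  (forall i : 'I_(Kn sys), 0 < sigma2 i) ->
  (forall n m, std_complex_normal P (fun t => Ht t n m)) ->
  mutually_independent P
    (fun (nm : 'I_(nris sys) * 'I_(nant sys)) t => Ht t nm.1 nm.2) ->
  (forall s : 'I_(nsub sys), (Gbar s)^t* *m Gbar s \in unitmx) ->
  (forall s : 'I_(nsub sys),
     {ae P, forall t, (Gtil s (Ht t))^t* *m Gtil s (Ht t) \in unitmx}) ->
  (forall (s : 'I_(nsub sys)) (j : 'I_(Kf sys)) i,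
     ('E_P[fun t => (cabs (wtil_LZF s j (Ht t) i 0) ^+ 2)%R] < +oo)%E) ->
  let wbar := @wbar_LZF R sys in
  let wtil s j t := @wtil_LZF R sys s j (Ht t) in
  let tau (j : 'I_(Kf sys)) (s s' : 'I_(nsub sys)) : R :=
    complex.Re (((gbar s k)^t*
      *m mxexp P (fun t => wtil s j t *m (wtil s' j t)^t*)
      *m gbar s' k) 0 0) in
  let Delta : R :=
    Pn sys * \sum_(i | i != k)
      cabs (\sum_(s in VRn i)
        (Num.sqrt (etan s i))%:C * ((gbar s k)^t* *m wbar s i) 0 0) ^+ 2
    + Pf sys * \sum_j \sum_(s in VRf j) \sum_(s' in VRf j)
        Num.sqrt (etaf s j * etaf s' j) * tau j s s' in
  ((forall s, s \in VRn k -> ~~ single_user s) ->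
   SE P k wbar wtil =
   log2 (1 + Pn sys * (\sum_(s in VRn k) Num.sqrt (etan s k)) ^+ 2
             / (Delta + sigma2 k)))
  /\
  SE P k wbar wtil =
  log2 (1 + Pn sys * (\sum_(s in VRn k) Num.sqrt (etan s k) *
                        (if single_user s
                         then \sum_i cabs (gbar s k i 0) ^+ 2 else 1)) ^+ 2
            / (Delta + sigma2 k)).
Proof.
move=> _ _ _ _ _ _ _ _ _ Pn0 Pf0 _ etaf0 _ Ht_normal _ uG _ W2 wbar wtil tau Delta.
have mHt : mxmeasurable Ht by move=> a b; have [? ? _ _ _] := Ht_normal a b.
have sqr_cabs_sqrt (p : R) z : 0 < p -> cabs ((Num.sqrt p)%:C * z) ^+ 2 =
    p * cabs z ^+ 2.
  move=> p0; rewrite ComplexField.Normc.normcM exprMn; congr (_ * _).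
  by rewrite cabs_sq /= expr0n addr0 sqr_sqrtr// ltW.
have DS_E : cabs (DS k wbar) ^+ 2 =
    Pn sys * (\sum_(s in VRn k) Num.sqrt (etan s k) *
      (if single_user s then \sum_i cabs (gbar s k i 0) ^+ 2 else 1)) ^+ 2.
  rewrite /DS sqr_cabs_sqrt//; congr (_ * _).
  under eq_bigr => s sk do rewrite gbar_wbar_LZF// -rmorphM.
  by rewrite -rmorph_sum cabs_sq /= expr0n addr0.
have UI_N_E : \sum_(i | i != k) cabs (UI_N k wbar i) ^+ 2 =
    Pn sys * \sum_(i | i != k) cabs (\sum_(s in VRn i)
      (Num.sqrt (etan s i))%:C * ((gbar s k)^t* *m wbar s i) 0 0) ^+ 2.
  by rewrite mulr_sumr; apply: eq_bigr => i _; rewrite /UI_N sqr_cabs_sqrt.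
pose X s j t := ((gbar s k)^t* *m wtil s j t) 0 0.
(* The conjugate of a scalar g^H w is w^H g, so each cross term is a bilinear form in the outer
   product of two precoders, as [cexp_bilinear] requires. *)
have XE j s s' t : X s j t * (X s' j t)^* =
    ((gbar s k)^t* *m (wtil s j t *m (wtil s' j t)^t*) *m gbar s' k) 0 0.
  rewrite !mulmxA -mulmxA [in RHS]mxE big_ord1; congr (_ * _).
  rewrite /X !mxE rmorph_sum; apply: eq_bigr => i _.
  by rewrite !mxE rmorphM [X in X * _]conjCK mulrC.
have iW j s s' a b : cintegrable P (fun t => (wtil s j t *m (wtil s' j t)^t*) a b).
  under eq_fun do rewrite mxE big_ord1 2!mxE.
  by apply: cintegrable_mulJ; rewrite ?W2//; exact: mxmeasurable_wtil_LZF.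
have iX j s s' : cintegrable P (fun t => X s j t * (X s' j t)^*).
  by under eq_fun do rewrite XE; exact: (cexp_bilinear _ _ _ _ _ _ (iW j s s')).1.
have tauE j s s' : complex.Re (cexp P (fun t => X s j t * (X s' j t)^*)) =
    tau j s s'.
  by under eq_fun do rewrite XE; rewrite (cexp_bilinear _ _ _ _ _ _ (iW j s s')).2.
have UI_F_E : \sum_j fine ('E_P[fun t => (cabs (UI_F k wtil j t) ^+ 2)%R])%E =
    Pf sys * \sum_j \sum_(s in VRf j) \sum_(s' in VRf j)
      Num.sqrt (etaf s j * etaf s' j) * tau j s s'.
  rewrite mulr_sumr; apply: eq_bigr => j _.
  (* The amplitude [Num.sqrt (Pf sys)] is absorbed into the real coefficients to reach the form of
     [expectation_cabs_sq_sum]; each cross term then returns it squared, as [Pf sys]. *)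
  have -> : (fun t => cabs (UI_F k wtil j t) ^+ 2) = fun t =>
      cabs (\sum_(s in VRf j)
        (Num.sqrt (Pf sys) * Num.sqrt (etaf s j))%:C * X s j t) ^+ 2.
    apply/funext => t; rewrite /UI_F mulr_sumr; congr (cabs _ ^+ 2).
    by apply: eq_bigr => s _; rewrite rmorphM mulrA.
  rewrite expectation_cabs_sq_sum; last exact: iX.
  rewrite mulr_sumr; apply: eq_bigr => s _.
  rewrite mulr_sumr; apply: eq_bigr => s' _.
  by rewrite tauE mulrACA -expr2 sqr_sqrtr ?ltW// sqrtrM// -!mulrA.
have SE_E : SE P k wbar wtil =
    log2 (1 + Pn sys * (\sum_(s in VRn k) Num.sqrt (etan s k) *
        (if single_user s then \sum_i cabs (gbar s k i 0) ^+ 2 else 1)) ^+ 2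
      / (Delta + sigma2 k)).
  by rewrite /SE /SINR DS_E UI_N_E UI_F_E.
split=> // no_single; rewrite SE_E; congr (log2 (1 + _ * _ ^+ 2 / _)).
by apply: eq_bigr => s /no_single/negbTE ->; rewrite mulr1.
Qed.
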